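(* Let $\{X(t)\}_{t\in\mathbb{T}}$ be a Markov process on $\mathbb{X}$ as described in the context. Assume that $\mathbb{X}$ is a length space and that there exist a continuous $\mathcal{V}\colon\mathbb{X}\to[1,\infty)$, a constant $b>0$, a nondecreasing differentiable concave function $\phi\colon[1,\infty)\to(0,\infty)$, and a (topologically) closed petite set $C\subseteq\mathbb{X}$ such that $$\mathbb{E}_x[\mathcal{V}(X(t))]-\mathcal{V}(x)\le b\int_{[0,t)}\mathbb{E}_x[\mathbf{1}_C(X(s))]\,\tau(ds)-\int_{[0,t)}\mathbb{E}_x[\phi\circ\mathcal{V}(X(s))]\,\tau(ds)\qquad\forall(t,x)\in\mathbb{T}\times\mathbb{X}.$$ Assume also that there exist a Lipschitz continuous function $L\colon\mathbb{X}\to[0,\infty)$ and constants $\theta>\vartheta\ge1$ and $c>0$ such that $$\mathcal{V}(x)\ge c\,L(x)^{\theta}\quad\text{and}\quad\phi\circ\mathcal{V}(x)\ge c\,L(x)^{\vartheta}\qquad\forall x\in\mathbb{X}.$$ In addition, suppose that $\{X(t)\}_{t\in\mathbb{T}}$ admits an invariant $\pi\in\mathcal{P}(\mathbb{X})$ such that $\int_{\mathbb{X}}L(x)^{\vartheta+\varepsilon}\,\pi(dx)=\infty$ for some $\varepsilon\in(0,\theta-\vartheta)$. Then, for each $p\in[1,\vartheta]$, $\iota\in(0,\theta-\vartheta-\varepsilon)$ and $x\in\mathbb{X}$, there exist a constant $\bar c>0$ and a diverging increasing sequence $\{t_n\}_{n\in\mathbb{N}}\subseteq\mathbb{T}$,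 depending on these parameters, such that $$\mathcal{W}_p(\delta_xP_{t_n},\pi)\ge\bar c\,(t_n+\mathcal{V}(x))^{-\frac{\vartheta-p+\varepsilon+\iota}{(\theta-\vartheta-\varepsilon-\iota)p}}\qquad\forall n\in\mathbb{N}.$$
   Context: $\mathbb{X}$ is a locally compact separable completely metrizable space with metric $\mathsf{d}$ and Borel $\sigma$-algebra $\mathfrak{B}(\mathbb{X})$. The time set $\mathbb{T}$ is $[0,\infty)$ or $\mathbb{Z}_+$. $\tau$ is Lebesgue measure on $\mathbb{T}$ if $\mathbb{T}=[0,\infty)$ and counting measure if $\mathbb{T}=\mathbb{Z}_+$. $\{X(t)\}_{t\in\mathbb{T}}$ is a time-homogeneous strong Markov process with state space $\mathbb{X}$, laws $\{\mathbb{P}_x\}_{x\in\mathbb{X}}$, $\mathbb{P}_x(X(0)=x)=1$, càdlàg sample paths (when $\mathbb{T}=[0,\infty)$), and conservative: $\mathbb{P}_x(X(t)\in\mathbb{X})=1$ for all $t,x$. Its transition kernel is $p(t,x,dy)=\mathbb{P}_x(X(t)\in dy)$, and $\delta_xP_t(dy)=p(t,x,dy)$. A Borel measure $\pi$ is invariant if $\int_{\mathbb{X}}p(t,x,dy)\,\pi(dx)=\pi(dy)$ for all $t\in\mathbb{T}$. A set $C\in\mathfrak{B}(\mathbb{X})$ is petite if there exist a probability measure $\chi$ on $\mathbb{T}$ and a non-trivial Borel measure $\nu_\chi$ on $\mathbb{X}$ such that $\int_{\mathbb{T}}p(t,x,B)\,\chi(dt)\ge\nu_\chi(B)$ for all $x\in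 C$, $B\in\mathfrak{B}(\mathbb{X})$. Length space: for $\gamma\in C([0,1];\mathbb{X})$ let $\Lambda(\gamma)=\sup_{k\in\mathbb{N}}\sup_{0=u_0<u_1<\dots<u_k=1}\sum_{i=1}^k\mathsf{d}(\gamma(u_{i-1}),\gamma(u_i))$; $\mathbb{X}$ is a length space if $\mathsf{d}(x,y)=\inf\{\Lambda(\gamma):\gamma\in C([0,1];\mathbb{X}),\gamma(0)=x,\gamma(1)=y\}$ for all $x,y\in\mathbb{X}$. $\mathcal{P}(\mathbb{X})$ is the set of Borel probability measures on $\mathbb{X}$. For $p\ge1$, $\mathcal{W}_p(\mu_1,\mu_2)=\inf_{\Pi}\left(\int_{\mathbb{X}\times\mathbb{X}}\mathsf{d}(x,y)^p\,\Pi(dx,dy)\right)^{1/p}$, the infimum being over all couplings $\Pi$ of $\mu_1,\mu_2$. *)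

(* Defs.v *)
From HB Require Import structures.
From mathcomp Require Import all_boot all_order all_algebra.
From mathcomp Require Import all_classical all_reals all_analysis.
From mathcomp Require Import measurable_realfun.

Set Implicit Arguments.
Unset Strict Implicit.
Unset Printing Implicit Defensive.

Import Order.TTheory GRing.Theory Num.Theory.
Import numFieldNormedType.Exports.

Local Open Scope classical_set_scope.
Local Open Scope ring_scope.

HB.mixin Record isBorel (d : measure_display) (R : realType) X
    & Metric R X & Measurable d X := {
  borelE : @measurable d X = <<s @open X >>
}.

#[short(type="borelMetricType")]
HB.structure Definition BorelMetric (d : measure_display) (R : realType) :=
  { X of Metric R X & Measurable d X & isBorel d R X }.

Section metric_spaces.
Context {R : realType}.

Definition separable (X : topologicalType) :=
  exists2 D : set X, countable D & dense D.

(* The complete metric [rho] need not be the metric [mdist] of the space. *)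
Definition completely_metrizable (X : metricType R) :=
  exists rho : X -> X -> R,
    [/\ [/\ forall x y, (rho x y = 0) <-> (x = y),
            forall x y, rho x y = rho y x &
            forall x y z, rho x z <= rho x y + rho y z],
        forall x (A : set X),
          nbhs x A <-> exists2 e, 0 < e & [set y | rho x y < e] `<=` A &
        forall u : nat -> X,
          (forall e, 0 < e -> exists N, forall m n,
              (N <= m)%N -> (N <= n)%N -> rho (u m) (u n) < e) ->
          exists l : X, u @ \oo --> l].

Definition curve_length (X : metricType R) (gamma : R -> X) : \bar R :=
  ereal_sup [set l | exists (k : nat) (u : nat -> R),
    [/\ u 0%N = 0, u k = 1, forall i, (i < k)%N -> u i < u i.+1 &
        l = (\sum_(i < k) mdist (gamma (u i)) (gamma (u i.+1)))%:E]].

Definition length_space (X : metricType R) :=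
  forall x y : X, (mdist x y)%:E =
    ereal_inf [set curve_length gamma | gamma in
      [set gamma : R -> X | [/\ {within `[0, 1], continuous gamma},
                                gamma 0 = x & gamma 1 = y]]].

Definition lipschitz_fun (X : metricType R) (f : X -> R) :=
  exists K : R, forall x y, `|f x - f y| <= K * mdist x y.

End metric_spaces.

Section wasserstein.
Context {d : measure_display} {R : realType} {X : borelMetricType d R}.
Local Open Scope ereal_scope.

(* The product sigma-algebra on X * X is the Borel one since the spaces
   considered are separable. *)
Definition coupling (mu nu : probability X R) : set (probability (X * X)%type R) :=
  [set Pi | forall B : set X, measurable B ->
     Pi (B `*` setT) = mu B /\ Pi (setT `*` B) = nu B].

Definition wasserstein (p : R) (mu nu : probability X R) : \bar R :=
  ereal_inf [set (\int[Pi]_z ((mdist z.1 z.2) `^ p)%:E) `^ p^-1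
            | Pi in coupling mu nu].

End wasserstein.

Variant time_kind := ContinuousTime | DiscreteTime.

(* Times are real numbers; what processes do outside [time_set k] is
   irrelevant, and integrals against [time_measure k] are always restricted
   to subsets of [time_set k]. *)
Definition time_set {R : realType} (k : time_kind) : set R :=
  match k with
  | ContinuousTime => [set t | 0 <= t]
  | DiscreteTime => range (fun n : nat => n%:R)
  end.

Definition time_measure {R : realType} (k : time_kind) :
    {measure set (measurableTypeR R) -> \bar R} :=
  match k with
  | ContinuousTime => lebesgue_measure
  | DiscreteTime => counting
  end.

Section markov_processes.
Context {dO d : measure_display} {R : realType}.
Context {Omega : measurableType dO} {X : borelMetricType d R}.
Variable k : time_kind.
Local Notation T := (@time_set R k).
Implicit Types (F : R -> set (set Omega)) (P : X -> probability Omega R)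
  (Y : R -> {mfun Omega >-> X}).

Definition filtration F :=
  (forall t, T t -> sigma_algebra setT (F t) /\ F t `<=` measurable) /\
  (forall s t, T s -> T t -> s <= t -> F s `<=` F t).

Definition adapted F Y :=
  forall t, T t -> forall B : set X, measurable B -> F t (Y t @^-1` B).

Definition stopping_time F (sigma : Omega -> \bar R) :=
  (forall w, sigma w = +oo%E \/ exists2 t, T t & sigma w = t%:E) /\
  (forall t, T t -> F t [set w | (sigma w <= t%:E)%E]).

Definition stopped_sigma_algebra F (sigma : Omega -> \bar R) : set (set Omega) :=
  [set A | measurable A /\
     forall t, T t -> F t (A `&` [set w | (sigma w <= t%:E)%E])].

(* [transition P Y t x] is the law p(t, x, dy) of X(t) under P_x. *)
Definition transition P Y (t : R) (x : X) : probability X R :=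
  distribution (P x) (Y t).

(* P_x(X(sigma + t) \in B | F_sigma) = p(t, X(sigma), B) on {sigma < oo},
   integrated over the events of F_sigma. *)
Definition strong_markov_property F P Y :=
  forall (x : X) (sigma : Omega -> \bar R), stopping_time F sigma ->
  forall A : set Omega, stopped_sigma_algebra F sigma A ->
  forall (t : R) (B : set X), T t -> measurable B ->
    P x (A `&` [set w | (sigma w < +oo)%E /\ B (Y (fine (sigma w) + t) w)]) =
    (\int[P x]_(w in A `&` [set w | (sigma w < +oo)%E])
       transition P Y t (Y (fine (sigma w)) w) B)%E.

Definition cadlag (f : R -> X) :=
  forall t : R, 0 <= t ->
    f @ t^'+ --> f t /\ (0 < t -> exists l : X, f @ t^'- --> l).

(* Conservativeness is built in: the process takes its values in X itself,
   without cemetery state. *)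
Record strong_markov_process F P Y : Prop := {
  smp_filtration : filtration F ;
  smp_adapted : adapted F Y ;
  smp_cadlag : k = ContinuousTime -> forall w, cadlag (fun t => Y t w) ;
  smp_start : forall x, P x (Y 0 @^-1` [set x]) = 1%E ;
  smp_kernel : forall t (B : set X), T t -> measurable B ->
    measurable_fun [set: X] (fun x => transition P Y t x B) ;
  smp_strong_markov : strong_markov_property F P Y }.

Definition invariant_measure P Y (pi : {measure set X -> \bar R}) :=
  forall t (B : set X), T t -> measurable B ->
    (\int[pi]_x transition P Y t x B)%E = pi B.

Definition petite P Y (C : set X) :=
  measurable C /\
  exists (chi : probability (measurableTypeR R) R) (nu : {measure set X -> \bar R}),
    [/\ chi T = 1%E, nu setT <> 0%E &
        forall (x : X) (B : set X), C x -> measurable B ->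
          (nu B <= \int[chi]_(t in T) transition P Y t x B)%E].

End markov_processes.

(* At the endpoint 1 the derivative is one-sided. *)
Definition differentiable_on_1oo {R : realType} (phi : R -> R) :=
  (forall u : R, 1 < u -> derivable phi u 1) /\
  cvg ((fun h : R => h^-1 * (phi (1 + h) - phi 1)) @ 0^'+).

(* Main.v *)
(** The drift condition gives [E_x V(X_t) <= V(x) + b t], so by Markov's
inequality [P_x(L(X_t) >= r / 2)] is at most of order
[(V(x) + t) r^(- theta)]. Since [L^(vartheta + eps)] is not [pi]-integrable,
[pi(L >= r) >= r^(- s)] with [s = vartheta + eps + iota] for arbitrarily large
[r]. For such [r], choose [t] proportional to [r^(theta - s)], so that the first
tail is at most [r^(- s) / 2]; any coupling must then move mass at least
[r^(- s) / 2] from [L < r / 2] to [L >= r], hence over a distance of order [r]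
as [L] is Lipschitz. Therefore [W_p^p] is at least of order [r^(p - s)], which
is the claimed power of [t + V(x)]. Taking [t] to be a natural number treats
both time sets at once. *)

Require Import Defs.
From mathcomp Require Import all_boot all_order all_algebra.
From mathcomp Require Import all_classical all_reals all_analysis.
From mathcomp Require Import measurable_realfun.
From mathcomp Require Import ring lra.

Set Implicit Arguments.
Unset Strict Implicit.
Unset Printing Implicit Defensive.

Import Order.TTheory GRing.Theory Num.Theory.
Import numFieldNormedType.Exports.

Local Open Scope classical_set_scope.
Local Open Scope ring_scope.

(** * Integral inequalities for functions that need not be measurable *)

Section integral_bounds.
Local Open Scope ereal_scope.
Context d (T : measurableType d) (R : realType).
Variable mu : {measure set T -> \bar R}.

(* No measurability is assumed: it would be a burden for [s |-> E_x f(X_s)], and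
   for [mdist] on the product sigma-algebra. *)
Lemma ge0_le_integral_nonmeasurable (D : set T) (f g : T -> \bar R) :
  (forall x, D x -> 0 <= f x) -> (forall x, D x -> f x <= g x) ->
  \int[mu]_(x in D) f x <= \int[mu]_(x in D) g x.
Proof.
move=> f0 fg; have g0 x : D x -> 0 <= g x.
  by move=> Dx; apply: le_trans (fg _ Dx); exact: f0.
rewrite !ge0_integralE//; apply: ge_ereal_sup => _ [h /= hf <-].
apply: ereal_sup_ubound; exists h => //= x; apply: le_trans (hf x) _.
by rewrite /patch; case: ifPn => // /set_mem /fg.
Qed.

Lemma integral_cst_indic (A : set T) (a : R) : measurable A -> (0 <= a)%R ->
  \int[mu]_x (a * \1_A x)%:E = a%:E * mu A.
Proof.
move=> mA a0; under eq_integral do rewrite EFinM.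
rewrite ge0_integralZl_EFin//; last exact/measurable_EFinP.
by rewrite integral_indic// setIT.
Qed.

(** Markov's inequality with the superlevel set replaced by a measurable subset [A]: the step
    function [a * \1_A] lies below [f]. *)
Lemma markov_nonmeasurable (A : set T) (a : R) (f : T -> R) :
  measurable A -> (0 <= a)%R -> (forall x, 0 <= f x)%R ->
  (forall x, A x -> a <= f x)%R ->
  a%:E * mu A <= \int[mu]_x (f x)%:E.
Proof.
move=> mA a0 f0 af; rewrite -integral_cst_indic//.
apply: ge0_le_integral_nonmeasurable => x _; rewrite lee_fin.
  by rewrite mulr_ge0.
rewrite indicE; have [Ax|nAx] := pselect (A x).
  by rewrite mem_set// mulr1 af.
by rewrite memNset// mulr0.
Qed.

End integral_bounds.

(** * Measurability of superlevel sets and of continuous functions *)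

Lemma measurable_superlevel d (T : measurableType d) (R : realType)
    (f : T -> R) (r : R) :
  measurable_fun setT f -> measurable [set x | r <= f x].
Proof.
by move=> mf; rewrite -preimage_itvcy -[X in measurable X]setTI; exact: mf.
Qed.

Lemma borel_continuous_measurable d (R : realType) (X : borelMetricType d R)
    (f : X -> R) : continuous f -> measurable_fun setT f.
Proof.
move=> cf; refine (@measurability _ _ X R setT f _ (RGenOpens.measurableE R) _).
move=> _ [_ [a [b ->] <-]]; rewrite setTI borelE.
apply: sub_sigma_algebra; move/continuousP : cf; apply.
exact: interval_open.
Qed.

Lemma lipschitz_continuous (R : realType) (X : metricType R) (f : X -> R) :
  lipschitz_fun f -> continuous f.
Proof.
move=> [K fK] x; apply/cvgrPdist_lt => e e0.
(* [lipschitz_fun] allows [K] to be zero or negative, so a positive constant is taken before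
   dividing. *)
have K0 : 0 < Num.max K 1 by rewrite lt_max ltr01 orbT.
have eK : 0 < e / Num.max K 1 by rewrite divr_gt0.
near=> y; apply: le_lt_trans (fK _ _) _.
have : mdist x y < e / Num.max K 1.
  by near: y; have := nbhsx_ballx x _ eK; rewrite ballEmdist.
rewrite ltr_pdivlMr// mulrC; apply: le_lt_trans.
by rewrite ler_wpM2r ?mdist_ge0// le_max lexx.
Unshelve. all: by end_near. Qed.

(** * Integer times and the drift condition *)

Lemma time_set_nat (R : realType) (k : time_kind) (n : nat) :
  time_set k (n%:R : R).
Proof. by case: k => /=; [rewrite ler0n | exists n]. Qed.

Lemma measurable_time_itv_nat (R : realType) (k : time_kind) (n : nat) :
  measurable (time_set k `&` `[0%R, n%:R[ : set (measurableTypeR R)).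
Proof.
case: k => /=.
  apply: measurableI; last exact: measurable_itv.
  by have := @measurable_itv R `[0, +oo[; rewrite set_itvE.
apply: measurableI; last exact: measurable_itv.
apply: countable_measurable; first by move=> t; exact: measurable_set1.
exact: card_image_le.
Qed.

(** The interval is half-open, so it contains [n] integers, as many as its Lebesgue length. *)
Lemma time_measure_itv_nat (R : realType) (k : time_kind) (n : nat) :
  (time_measure k (time_set k `&` `[0%R, n%:R[ : set (measurableTypeR R))
     <= (n%:R : R)%:E)%E.
Proof.
case: k => /=.
  apply: (@le_trans _ _ (lebesgue_measure (`[0%R, n%:R[ : set (measurableTypeR R)))).
    apply: le_measure; rewrite ?inE.
    - exact: (@measurable_time_itv_nat R ContinuousTime n).
    - exact: measurable_itv.
    - exact: subIsetr.
  by rewrite lebesgue_measure_itv/= lte_fin; case: ifPn => _; rewrite ?sube0 ?lee_fin.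
set D := _ `&` _; have DE : D = (fun i => i%:R) @` `I_n.
  apply/seteqP; rewrite /D; split=> t /=; rewrite in_itv/=.
    by move=> [[i _ <-]] /andP[_]; rewrite ltr_nat => ?; exists i.
  by move=> [i ni <-]; rewrite ler0n ltr_nat ni; split => //; exists i.
have finD : finite_set D by rewrite DE; exact/finite_image/finite_II.
rewrite /counting asboolT// lee_fin ler_nat.
by apply: geq_card_fset_set; rewrite DE; exact: card_image_le.
Qed.

(** The integral of [g] only lowers the right-hand side, and [f <= 1] bounds the other integral by
    the measure of the interval. Here [E] stands for the mean of [V] at time [n], not known
    beforehand to be finite. *)
Lemma drift_bound (R : realType) (k : time_kind) (n : nat) (v b : R)
    (E : \bar R) (f g : R -> \bar R) :
  0 <= b ->
  (forall s, 0 <= f s <= 1)%E -> (forall s, 0 <= g s)%E ->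
  (E - v%:E <= b%:E * \int[time_measure k]_(s in time_set k `&` `[0%R, n%:R[) f s
          - \int[time_measure k]_(s in time_set k `&` `[0%R, n%:R[) g s)%E ->
  (E <= (v + b * n%:R)%:E)%E.
Proof.
move=> b0 f01 g0 Ev.
have mD := @measurable_time_itv_nat R k n.
rewrite addrC EFinD -leeBlDr//; apply: le_trans Ev _.
rewrite -[leRHS]sube0; apply: leeB; last exact: integral_ge0.
rewrite EFinM lee_wpmul2l ?lee_fin//.
apply: (le_trans _ (@time_measure_itv_nat R k n)).
rewrite -[leRHS]mul1e -integral_cst//.
by apply: ge0_le_integral_nonmeasurable => s _; have /andP[] := f01 s.
Qed.

(** * Tails of functions with an infinite moment *)

Lemma moment_infinite_tail d (T : measurableType d) (R : realType)
    (mu : probability T R) (f : T -> R) (q iota M : R) :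
  measurable_fun setT f -> (forall x, 0 <= f x) -> 0 <= q -> 0 < iota ->
  (\int[mu]_x ((f x) `^ q)%:E = +oo)%E ->
  exists r, [/\ M <= r, 0 < r &
    ((r `^ (- (q + iota)))%:E <= mu [set x | (r <= f x)%R])%E].
Proof.
move=> mf f0 q0 iota0 int_oo; apply: contrapT => nex.
(* Otherwise the dyadic bound [f^q <= r_0^q + \sum_n r_(n+1)^q 1_(f >= r_n)],
   with [r_n = 2^n r_0], integrates to a convergent geometric series. *)
pose r0 := Num.max M 1; have r0_gt0 : 0 < r0 by rewrite lt_max ltr01 orbT.
pose r n := 2 ^+ n * r0; pose A n := [set x | r n <= f x].
have r_gt0 n : 0 < r n by rewrite mulr_gt0// exprn_gt0.
have rS n : r n.+1 = 2 * r n by rewrite /r exprS mulrA.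
have mA n : measurable (A n) by exact: measurable_superlevel.
have tail n : (mu (A n) <= (r n `^ (- (q + iota)))%:E)%E.
  rewrite leNgt; apply/negP => lt; apply: nex; exists (r n); split => //.
    apply: (@le_trans _ _ r0); first by rewrite le_max lexx.
    by rewrite /r ler_peMl ?(ltW r0_gt0)// exprn_ege1// ler1n.
  exact: ltW.
pose a n := r n.+1 `^ q; pose z : R := 2 `^ (- iota).
pose c := 2 `^ q * r0 `^ (- iota).
(* On the shell from [r n] to [r n.+1], [f ^ q] is at most [a n]. Multiplied by the assumed tail
   bound this is a geometric term, whose ratio [z] is below 1 because [iota > 0]. *)
have az n : a n * r n `^ (- (q + iota)) = c * z ^+ n.
  rewrite /a rS powRM ?ltW// -mulrA -powRD; last first.
    by apply/implyP => _; rewrite gt_eqF.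
  rewrite opprD addrA subrr add0r /r powRM ?exprn_ge0 ?ltW//.
  rewrite -[2 ^+ n]powR_mulrn// powRAC -/z powR_mulrn ?powR_ge0//.
  by rewrite /c mulrCA mulrC -!mulrA; congr (_ * _); rewrite mulrC.
have z_gt0 : 0 < z by exact: powR_gt0.
have z_lt1 : `|z| < 1.
  rewrite gtr0_norm// /z powRN invf_lt1 ?powR_gt0//.
  have := @gt0_ltr_powR R iota iota0 1 2; rewrite !nnegrE powR1.
  by apply; rewrite ?ltr1n.
have mterm n : measurable_fun setT (fun x => (a n * \1_(A n) x)%:E).
  by apply/measurable_EFinP/measurable_funM => //; exact: measurable_indic.
have term0 n x : (0 <= (a n * \1_(A n) x)%:E)%E.
  by rewrite lee_fin mulr_ge0 ?powR_ge0.
have : (\int[mu]_x ((f x) `^ q)%:E <=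
    \int[mu]_x ((r0 `^ q)%:E + \sum_(n <oo) (a n * \1_(A n) x)%:E))%E.
  apply: ge0_le_integral_nonmeasurable => x _; first by rewrite lee_fin powR_ge0.
  have [fr0|r0f] := ltP (f x) r0.
    rewrite -[leLHS]adde0; apply: leeD; last exact: nneseries_ge0.
    by rewrite lee_fin ge0_ler_powR ?nnegrE// ltW.
  have exn : exists n, f x < r n.+1.
    (* With [N] the integer part of [f x / r0], [f x / r0 < N + 1 < 2 ^ (N + 1)]. *)
    exists (Num.trunc (f x / r0)); rewrite -ltr_pdivrMr//.
    have /truncn_itv/andP[_] : 0 <= f x / r0 by rewrite divr_ge0// ltW.
    move/lt_trans; apply; rewrite -natrX ltr_nat.
    exact: ltn_expl.
  (* The least such [n] also satisfies [r n <= f x], so the single term of index [n] already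
     dominates [f x ^ q]. *)
  have [n fn nmin] := ex_minnP exn.
  have rn : r n <= f x.
    case: n fn nmin => [|n] _ nmin; first by rewrite /r expr0 mul1r.
    by rewrite leNgt; apply/negP => /nmin; rewrite ltnn.
  rewrite -[leLHS]add0e; apply: leeD; first by rewrite lee_fin powR_ge0.
  apply: le_trans (nneseries_lim_ge n.+1 _) => //.
  rewrite big_nat_recr//= -[leLHS]add0e; apply: leeD; first exact: sume_ge0.
  by rewrite lee_fin indicE mem_set// mulr1 ge0_ler_powR ?nnegrE// ltW.
rewrite int_oo ge0_integralD//; first last.
- exact: ge0_emeasurable_sum.
- by move=> x _; exact: nneseries_ge0.
- by move=> x _; rewrite lee_fin powR_ge0.
rewrite integral_cst//= probability_setT mule1 integral_nneseries//.
have : (\sum_(n <oo) \int[mu]_x (a n * \1_(A n) x)%:E <= (c * (1 - z)^-1)%:E)%E.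
  apply: lime_le.
    by apply: is_cvg_nneseries => n _ _; exact: integral_ge0.
  apply: nearW => n.
  apply: (@le_trans _ _ (\sum_(0 <= i < n) (c * z ^+ i)%:E)%E).
    apply: lee_sum => i _; rewrite integral_cst_indic ?powR_ge0// -az EFinM.
    by apply: lee_wpmul2l; [rewrite lee_fin powR_ge0|exact: tail].
  rewrite sumEFin lee_fin; apply: geometric_le_lim => //.
  by rewrite mulr_ge0 ?powR_ge0.
move=> sum_le oo_le.
have := le_trans oo_le (leeD (lexx (r0 `^ q)%:E) sum_le).
by rewrite -EFinD leye_eq.
Qed.

(** * Lower bounds on the Wasserstein distance *)

Lemma wasserstein_ge_tails d (R : realType) (X : borelMetricType d R)
    (mu nu : probability X R) (L : X -> R) (K p r s m : R) :
  measurable_fun setT L ->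
  (forall x y, `|L x - L y| <= K * mdist x y) -> 0 < K -> 0 < p ->
  0 <= s -> 0 <= m ->
  (mu [set x | (r <= L x)%R] + m%:E <= nu [set x | (r + s <= L x)%R])%E ->
  ((((s / K) `^ p * m) `^ p^-1)%:E <= wasserstein p mu nu)%E.
Proof.
move=> mL LK K0 p0 s0 m0; set A := [set x | r <= L x].
set B := [set x | r + s <= L x] => muAnuB.
have mA : measurable A by exact: measurable_superlevel.
have mB : measurable B by exact: measurable_superlevel.
apply: le_ereal_inf_tmp => _ [Pi cPi <-].
have sKp0 : 0 <= (s / K) `^ p by exact: powR_ge0.
(* On [E] the values of [L] differ by more than [s], so the points are at distance at least
   [s / K]. *)
pose E := ~` A `*` B.
have mE : measurable E by apply: measurableX => //; exact: measurableC.
have mPi : (m%:E <= Pi E)%E.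
  (* A pair with second point in [B] lies in [E] or has its first point in [A]; the marginals then
     give [nu B <= Pi E + mu A]. *)
  have PiB : (Pi ([set: X] `*` B) <= Pi E + Pi (A `*` [set: X]))%E.
    have mAX : measurable (A `*` [set: X]) by exact: measurableX.
    apply: le_trans (measureU2 _ mE mAX).
    apply: le_measure; rewrite ?inE; [exact: measurableX|exact: measurableU|].
    move=> [x y] [_ By]; have [Ax|nAx] := pselect (A x); [right|left]; split => //.
  rewrite (cPi _ mA).1 (cPi _ mB).2 in PiB.
  have := le_trans muAnuB PiB; rewrite addeC leeD2rE//.
  exact: fin_num_measure.
rewrite -poweR_EFin; apply: gt0_ler_poweR.
- by rewrite invr_ge0 ltW.
- by rewrite in_itv/= leey andbT lee_fin mulr_ge0.
- rewrite in_itv/= leey andbT integral_ge0// => z _.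
  by rewrite lee_fin powR_ge0.
apply: (@le_trans _ _ (((s / K) `^ p)%:E * Pi E)%E).
  by rewrite EFinM lee_wpmul2l// lee_fin.
apply: markov_nonmeasurable => // [z|[x y] [/= nAx By]]; first exact: powR_ge0.
apply: ge0_ler_powR; rewrite ?nnegrE ?mdist_ge0 ?(ltW p0)//.
  by rewrite divr_ge0// ltW.
rewrite ler_pdivrMr// mulrC; apply: le_trans (LK x y).
rewrite distrC; apply: le_trans (ler_norm _).
have : L x < r by rewrite ltNge; exact/negP.
by move: By; rewrite /B/=; lra.
Qed.

Lemma frequently_increasing (P : nat -> Prop) :
  (forall M, exists n, (M < n)%N /\ P n) ->
  exists2 u : nat -> nat, (forall n, P (u n)) & forall n, (u n < u n.+1)%N.
Proof.
(* Iteration starts at [g 0], since [P 0] itself may fail. *)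
move=> /choice[g gP]; exists (fun n => iter n.+1 g 0%N) => n.
  by rewrite iterS; case: (gP (iter n g 0%N)).
by rewrite [X in (_ < X)%N]iterS; case: (gP (iter n.+1 g 0%N)).
Qed.

(** The process enters only through the tail bound on its laws [mu n] at integer times. The constant
    is fixed before [M], so it serves all the times found. *)
Lemma wasserstein_frequent_rate d (R : realType) (X : borelMetricType d R)
    (mu : nat -> probability X R) (nu : probability X R) (L : X -> R)
    (K c v b theta q iota p : R) :
  measurable_fun setT L -> (forall x, 0 <= L x) ->
  (forall x y, `|L x - L y| <= K * mdist x y) -> 0 < K ->
  0 < c -> 1 <= v -> 0 < p -> 0 <= q -> 0 < iota ->
  p <= q + iota -> q + iota < theta ->
  (forall n r, 0 < r ->
    ((c * r `^ theta)%:E * mu n [set x | (r <= L x)%R] <= (v + b * n%:R)%:E)%E) ->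
  (\int[nu]_x ((L x) `^ q)%:E = +oo)%E ->
  exists2 cbar : R, 0 < cbar & forall M, exists n, (M < n)%N /\
    ((cbar * (n%:R + v) `^
        (- ((q + iota - p) / ((theta - (q + iota)) * p))))%:E
      <= wasserstein p (mu n) nu)%E.
Proof.
move=> mL L0 LK K0 c0 v1 p0 q0 iota0; set s := q + iota => ps stheta muL nuL.
set D := theta - s; set e := (s - p) / (D * p).
have v0 : 0 < v by exact: lt_le_trans v1.
have D0 : 0 < D by rewrite subr_gt0.
have e0 : 0 <= e by rewrite divr_ge0 ?subr_ge0// mulr_ge0// ltW.
(* [B >= b] and [B >= 1] together give [v + b * n <= B * (v + n)]. *)
pose B := Num.max b 1; have B1 : 1 <= B by rewrite le_max lexx orbT.
have bB : b <= B by rewrite le_max lexx.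
have B0 : 0 < B by apply: lt_le_trans B1.
(* The factor [h] comes from evaluating the tail at [rho / 2], and the 2 in [kappa] and in [g] from
   the mass [m = rho ^ (- s) / 2]. *)
pose h : R := 2^-1 `^ theta; have h0 : 0 < h by rewrite powR_gt0// invr_gt0.
pose kappa := c * h / 2; have kappa0 : 0 < kappa by rewrite !mulr_gt0// invr_gt0.
pose g := (2 * K)^-1 `^ p / 2.
have g0 : 0 < g by rewrite mulr_gt0// powR_gt0// invr_gt0 mulr_gt0.
exists (g `^ p^-1 * (2 * B / kappa) `^ (- e)).
  by rewrite mulr_gt0// powR_gt0// divr_gt0// mulr_gt0.
move=> M; pose rho0 := ((M.+1%:R + v) * B / kappa) `^ D^-1.
have [rho [rho0_le rho_gt0 nu_rho]] :=
  moment_infinite_tail rho0 mL L0 q0 iota0 nuL.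
(* [y] solves [B * (v + y) = kappa * rho ^ D], and [rho >= rho0] makes [y >= M + 1]. Its integer
   part [n] is the largest integer time for which this tail estimate applies. *)
pose y := kappa * rho `^ D / B - v.
have My : M.+1%:R <= y.
  have : (M.+1%:R + v) * B / kappa <= rho `^ D.
    have z0 : 0 < (M.+1%:R + v) * B / kappa.
      by rewrite divr_gt0// mulr_gt0// addr_gt0.
    have -> : (M.+1%:R + v) * B / kappa = rho0 `^ D.
      by rewrite /rho0 -powRrM mulVf ?lt0r_neq0// powRr1// ltW.
    by rewrite ge0_ler_powR ?nnegrE ?powR_ge0 ?(ltW D0) ?(ltW rho_gt0).
  by rewrite ler_pdivrMr// -ler_pdivlMr// /y lerBrDr [rho `^ D * _]mulrC.
have y0 : 0 <= y by apply: le_trans My.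
pose n := Num.trunc y.
have /andP[ny yn] : n%:R <= y < n.+1%:R by exact: truncn_itv.
exists n; split; first by rewrite /n truncn_ge_nat.
have nv : B * (v + n%:R) <= kappa * rho `^ D.
  by rewrite mulrC -ler_pdivlMr// addrC -lerBrDr.
(* Rounding costs a factor 2: [y + v < n + 1 + v <= 2 * (n + v)] as [v >= 1]. *)
have rho_nv : rho `^ D <= 2 * B / kappa * (n%:R + v).
  have : kappa * rho `^ D / B <= 2 * (n%:R + v).
    by move: yn (ler0n R n); rewrite /y -natr1; lra.
  rewrite ler_pdivrMr// [_ / kappa * _]mulrAC ler_pdivlMr// mulrC.
  by rewrite [2 * _ * _]mulrAC.
pose m := rho `^ (- s) / 2.
have m0 : 0 <= m by rewrite divr_ge0 ?powR_ge0.
have muL_m : (mu n [set x | (rho / 2 <= L x)%R] <= m%:E)%E.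
  have rho2 : 0 < rho / 2 by rewrite divr_gt0.
  have cr0 : 0 < c * (rho / 2) `^ theta by rewrite mulr_gt0// powR_gt0.
  rewrite -(@lee_pmul2l _ (c * (rho / 2) `^ theta)%:E)//.
  apply: le_trans (muL n _ rho2) _; rewrite -EFinM lee_fin.
  have -> : c * (rho / 2) `^ theta * m = kappa * rho `^ D.
    rewrite powRM ?ltW// /m /kappa -/h /D powRD; first ring.
    by apply/implyP => _; rewrite gt_eqF.
  apply: le_trans nv; rewrite mulrDr lerD//.
    by rewrite ler_peMl// (le_trans ler01).
  by rewrite ler_wpM2r.
have := @wasserstein_ge_tails d R X (mu n) nu L K p (rho / 2) (rho / 2) m
  mL LK K0 p0.
rewrite -splitr => W; apply: le_trans (W _ m0 _); first last.
- apply: le_trans nu_rho.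
  have -> : rho `^ (- s) = m + m by rewrite /m -splitr.
  by rewrite EFinD leeD2r.
- by rewrite divr_ge0// ltW.
rewrite lee_fin.
have -> : (rho / 2 / K) `^ p * m = g * rho `^ (p - s).
  rewrite -mulrA -invfM powRM ?ltW ?invr_gt0 ?mulr_gt0//.
  rewrite /m /g powRD; first ring.
  by apply/implyP => _; rewrite gt_eqF.
rewrite [leRHS]powRM ?powR_ge0 ?(ltW g0)// -mulrA ler_pM2l ?powR_gt0//.
(* The bound on [rho ^ D] from above becomes one from below, the exponent [- e] being nonpositive
   because [p <= s]. *)
rewrite -powRrM (_ : (p - s) / p = D * - e); last first.
  by rewrite /e; field; rewrite !gt_eqF.
have k0 : 0 < 2 * B / kappa by rewrite divr_gt0// mulr_gt0.
have nv0 : 0 < n%:R + v by rewrite ltr_wpDl.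
rewrite powRrM -powRM ?(ltW k0) ?(ltW nv0)//.
rewrite !powRN lef_pV2 ?posrE ?powR_gt0 ?(mulr_gt0 k0 nv0)//.
by apply: ge0_ler_powR; rewrite // nnegrE ?powR_ge0// ltW// mulr_gt0.
Qed.

Theorem theorem1p2 (R : realType) (dO d : measure_display)
    (Omega : measurableType dO) (X : borelMetricType d R)
    (k : time_kind) (F : R -> set (set Omega))
    (P : X -> probability Omega R) (Y : R -> {mfun Omega >-> X})
    (X_locally_compact : locally_compact [set: X])
    (X_separable : separable X)
    (X_completely_metrizable : completely_metrizable X)
    (Y_markov : strong_markov_process k F P Y)
    (X_length : length_space X)
    (V : X -> R) (b : R) (phi : R -> R) (C : set X)
    (V_continuous : continuous V) (V_ge1 : forall x, 1 <= V x)
    (b_gt0 : 0 < b)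
    (phi_gt0 : forall u, 1 <= u -> 0 < phi u)
    (phi_nondecreasing : {in `[1, +oo[ &, {homo phi : u v / u <= v}})
    (phi_differentiable : differentiable_on_1oo phi)
    (phi_concave :
      convex_function (`[1, +oo[%classic : set R^o) (fun u => - phi u))
    (C_closed : closed C) (C_petite : petite k P Y C)
    (drift : forall (t : R) (x : X), time_set k t ->
      ('E_(P x)[V \o Y t] - (V x)%:E <=
         b%:E * \int[time_measure k]_(s in time_set k `&` `[0%R, t[)
                   'E_(P x)[\1_C \o Y s]
         - \int[time_measure k]_(s in time_set k `&` `[0%R, t[)
              'E_(P x)[phi \o V \o Y s])%E)
    (L : X -> R) (theta vartheta c : R)
    (L_lipschitz : lipschitz_fun L) (L_ge0 : forall x, 0 <= L x)
    (vartheta_ge1 : 1 <= vartheta) (theta_gt : vartheta < theta)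
    (c_gt0 : 0 < c)
    (V_lower : forall x, c * (L x) `^ theta <= V x)
    (phiV_lower : forall x, c * (L x) `^ vartheta <= phi (V x))
    (pi : probability X R) (pi_invariant : invariant_measure k P Y pi)
    (eps : R) (eps_gt0 : 0 < eps) (eps_lt : eps < theta - vartheta)
    (pi_tail : (\int[pi]_x ((L x) `^ (vartheta + eps))%:E = +oo)%E) :
  forall (p iota : R) (x : X),
    1 <= p <= vartheta -> 0 < iota < theta - vartheta - eps ->
    exists (cbar : R) (t_ : nat -> R),
      [/\ 0 < cbar,
          forall n, time_set k (t_ n),
          increasing_seq t_,
          t_ @ \oo --> +oo &
          forall n,
            ((cbar * (t_ n + V x) `^
                (- ((vartheta - p + eps + iota) /
                    ((theta - vartheta - eps - iota) * p))))%:E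
             <= wasserstein p (transition P Y (t_ n) x) pi)%E].
Proof.
move=> p iota x /andP[p1 ptheta] /andP[iota0 iota_lt].
have Lc := lipschitz_continuous L_lipschitz.
have mL := borel_continuous_measurable Lc.
have [K LK] := L_lipschitz.
have K0 : 0 < Num.max K 1 by rewrite lt_max ltr01 orbT.
have p0 : 0 < p by exact: lt_le_trans p1.
have V0 z : 0 <= V z by exact: le_trans (V_ge1 z).
(* Markov's inequality is applied to [V], which is at least [c * r ^ theta] where [L >= r]; the
   drift condition bounds its mean. *)
have tail n r : 0 < r ->
    ((c * r `^ theta)%:E * transition P Y n%:R x [set z | (r <= L z)%R]
      <= (V x + b * n%:R)%:E)%E.
  move=> r0; apply: (@le_trans _ _ 'E_(P x)[V \o Y n%:R]%E).
    rewrite unlock; apply: markov_nonmeasurable => [||w|w rL].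
    - rewrite -[X in measurable X]setTI.
      exact: (measurable_funP (Y n%:R)) measurableT _ (measurable_superlevel r mL).
    - by rewrite mulr_ge0 ?powR_ge0 ?ltW.
    - exact: V0.
    - apply: le_trans (V_lower _); rewrite ler_pM2l//.
      by apply: ge0_ler_powR; rewrite ?nnegrE ?L_ge0 ?(ltW r0)//; lra.
  apply: (@drift_bound R k n (V x) b _ (fun s => 'E_(P x)[\1_C \o Y s])%E
    (fun s => 'E_(P x)[phi \o V \o Y s])%E); last exact/drift/time_set_nat.
  - exact: ltW.
  - move=> s; rewrite unlock integral_ge0 => [|w _]; last by rewrite lee_fin.
    apply: (@le_trans _ _ (\int[P x]_w (cst 1 w))%E).
      apply: ge0_le_integral_nonmeasurable => w _; rewrite lee_fin//.
      by rewrite /= indicE lern1 leq_b1.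
    by rewrite integral_cst//= probability_setT mule1.
  - move=> s; rewrite unlock integral_ge0// => w _.
    by rewrite lee_fin ltW// phi_gt0.
have [||||cbar cbar0 freq] := @wasserstein_frequent_rate d R X
    (fun n => transition P Y n%:R x) pi L (Num.max K 1) c (V x) b theta
    (vartheta + eps) iota p mL L_ge0 _ K0 c_gt0 (V_ge1 x) p0 _ iota0 _ _ tail
    pi_tail.
- move=> y z; apply: le_trans (LK y z) _.
  by rewrite ler_wpM2r ?mdist_ge0// le_max lexx.
- by lra.
- by lra.
- by lra.
have [u uP u_inc] := frequently_increasing freq.
exists cbar, (fun n => (u n)%:R); split => //.
- by move=> n; exact: time_set_nat.
- by apply/increasing_seqP => n; rewrite ltr_nat.
(* A strictly increasing sequence of naturals dominates its index, hence diverges. *)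
- have le_u n : (n <= u n)%N.
    by elim: n => // n IH; exact: leq_ltn_trans (u_inc n).
  apply/cvgryPge => A; near=> n; apply: (@le_trans _ _ n%:R).
    by near: n; exact: nbhs_infty_ger.
  by rewrite ler_nat.
- move=> n; have := uP n.
  rewrite (_ : vartheta + eps + iota - p = vartheta - p + eps + iota); last by ring.
  rewrite (_ : theta - (vartheta + eps + iota) = theta - vartheta - eps - iota) //.
  by ring.
Unshelve. all: by end_near. Qed.
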